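(* Let $n>k>0$ be integers and let $L=\{\ell_1,\ell_2,\ldots,\ell_s\}\subset[0,k-1]$ with $\ell_1<\ell_2<\cdots<\ell_s$. Suppose $L$ contains $b$ full runs of consecutive integers, and let $m_i$ be the length of the $i$th full run for $1\le i\le b$. Set \[K(k,L)=\prod_{i=1}^{b}m_i!\cdot\frac{\binom{k}{k-\ell_1}\binom{k-\ell_1-1}{k-\ell_2}\cdots\binom{k-\ell_{s-1}-1}{k-\ell_s}}{\prod_{i=1}^s(\ell_i+1)(k-\ell_i)}.\] Then there is a constant $c$ depending on $k$ and $L$ but not on $n$ such that \[\vartheta(G(n,k,L))\ge K(k,L)\,n^s-cn^{s-1},\] and a constant $C$ depending on $k$ and $L$ but not on $n$ such that \[\vartheta(G(n,k,L))\le K(k,L)\,n^s+Cn^{s-1}.\] In particular, for fixed $k$ and $L$, $\vartheta(G(n,k,L))=\Theta(n^{|L|})$ as $n\to\infty$.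
   Context: For integers $a\le b$, $[a,b]=\{a,a+1,\ldots,b\}$ and $[b]=[1,b]$; $\binom{[n]}{k}$ is the family of $k$-subsets of $[n]$. For $L\subset[0,k-1]$, the generalized Johnson graph $G(n,k,L)$ has vertex set $\binom{[n]}{k}$, with $A,B$ adjacent iff $|A\cap B|\notin L$. For a graph $G$ on $N$ vertices, the Lovász number is $\vartheta(G)=\max\sum_{i,j}b_{ij}$ over all $N\times N$ positive semidefinite matrices $B=(b_{ij})$ with trace $1$ and $b_{ij}=0$ whenever $ij$ is an edge. For $L=\{\ell_1<\cdots<\ell_s\}$, a subset $\{\ell_m,\ldots,\ell_{m+p}\}$ is a run if $\ell_{m+i}=\ell_m+i$ for $0\le i\le p$; it is a full run if moreover ($m=1$ or $\ell_{m-1}<\ell_m-1$) and ($m+p=s$ or $\ell_{m+p+1}>\ell_{m+p}+1$). $L$ decomposes uniquely into full runs; the length of a run is its cardinality. *)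

(* Defs.v *)
From HB Require Import structures.
From mathcomp Require Import all_boot all_order all_algebra.
From mathcomp Require Import classical_sets reals.
Set Implicit Arguments. Unset Strict Implicit. Unset Printing Implicit Defensive.
Import Order.TTheory GRing.Theory Num.Theory.
Local Open Scope classical_set_scope.
Local Open Scope ring_scope.

Definition theta_feasible (R : realType) (V : finType) (adj : rel V)
    (B : V -> V -> R) : Prop :=
  [/\ (forall i j, B i j = B j i),
      (forall x : V -> R, 0 <= \sum_i \sum_j x i * B i j * x j),
      \sum_i B i i = 1
    & (forall i j, adj i j -> B i j = 0)].

Definition lovasz_theta (R : realType) (V : finType) (adj : rel V) : R :=
  sup [set v : R | exists B : V -> V -> R,
         theta_feasible adj B /\ v = \sum_i \sum_j B i j].

Definition ksub (n k : nat) := {A : {set 'I_n} | #|A| == k}.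

Definition johnson_adj (n k : nat) (L : {set 'I_k}) : rel (ksub n k) :=
  fun A B => (A != B) &&
    ~~ [exists l in L, nat_of_ord l == #|val A :&: val B|].

Definition Lseq (k : nat) (L : {set 'I_k}) : seq nat :=
  sort leq [seq nat_of_ord x | x <- enum L].

(* {l_(j), ..., l_(j+p)} (0-indexed) is a full run of the increasing list l *)
Definition full_run (l : seq nat) (j p : nat) : bool :=
  [&& j + p < size l,
      [forall i : 'I_p.+1, nth 0 l (j + i) == nth 0 l j + i],
      (j == 0) || (nth 0 l j.-1 + 1 < nth 0 l j)
    & (j + p == (size l).-1) || (nth 0 l (j + p) + 1 < nth 0 l (j + p).+1)]%N.

Definition Kconst (R : realType) (k : nat) (L : {set 'I_k}) : R :=
  let l := Lseq L in
  let s := size l in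
  let lt := fun i => nth 0 l i in
  let runfact := (\prod_(j < s) \prod_(p < s | full_run l j p) (p.+1)`!)%N in
  let bins := (\prod_(i < s)
                 'C(if i == 0 :> nat then k else k - lt i.-1 - 1, k - lt i))%N in
  let den := (\prod_(i < s) ((lt i).+1 * (k - lt i)))%N in
  (runfact * bins)%:R / den%:R.

Arguments johnson_adj n {k} L.
Arguments Kconst R {k} L.
Arguments lovasz_theta {R V} adj.

(* Main.v *)
(** The proof runs through a duality between [L] and its complement [L'] in
    [0, k-1].  For each level [j] there is a positive semidefinite kernel
    [kern e k j |A :&: B|], [e = 1/n], essentially supported on the [j]-th
    eigenspace of the Johnson scheme.  Solving a linear system over the levels [0]
    and [l + 1], [l] in [L], produces [F = 1 + sum_(l in L) u_l * kern e k (l+1)]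
    that vanishes on [L], with [u_l >= 0] for [n] large.  Pairing a feasible matrix
    with [F] gives [theta <= F k]; and the function [F'] obtained in the same way
    from [L'] is, up to normalisation, itself feasible for [L], so that
    [theta >= 'C(n, k) / F' k].  After rescaling by powers of [n] the system is
    polynomial in [e] and its limit at [e = 0] can be solved explicitly, whence
    [F k = c(L) n^s + O(n^(s-1))]; the bounds match because
    [c(L) * c(L') = 1 / k!]. *)
Require Import Defs.
From HB Require Import structures.
From mathcomp Require Import all_boot all_order all_algebra.
From mathcomp Require Import classical_sets reals boolp.
From mathcomp Require Import finset zify ring lra.
Import Order.TTheory GRing.Theory Num.Theory.
Local Open Scope ring_scope.

(** * Positive semidefinite kernels *)

(** The number of matchings of size [j - r] between two sets of size [k - r]. *)
Definition kcoef (k j r : nat) : nat := ((j - r)`! * 'C(k - r, j - r) ^ 2)%N.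

(** For [k]-sets A, B with [t] common points: the sum over [j]-edge matchings between A and B of the
    product of [[a = b] - e] over the edges ab; [r] counts the edges where [[a = b]] is picked. *)
Definition kern {R : realFieldType} (e : R) (k j t : nat) : R :=
  \sum_(r < j.+1) ('C(t, r) * kcoef k j r)%:R * (- e) ^+ (j - r).

(** Both sides count pairs of a point [a] of [A] and an [r]-subset of [A :&: C] avoiding [a]. *)
Lemma sum_bin_setD1 (T : finType) (A C : {set T}) (r : nat) :
  (\sum_(a in A) 'C(#|(A :\ a) :&: C|, r) = (#|A| - r) * 'C(#|A :&: C|, r))%N.
Proof.
rewrite (bigID (mem C)) /=.
have -> : (\sum_(a in A | a \in C) 'C(#|(A :\ a) :&: C|, r) =
   \sum_(a in A :&: C) 'C(#|A :&: C|.-1, r))%N.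
  apply: eq_big => [a|a /andP[aA aC]]; first by rewrite inE.
  rewrite (cardsD1 a (A :&: C)) inE aA aC /=.
  by congr ('C(#|pred_of_set _|, _)); apply/setP=> x; rewrite !inE andbA.
have -> : (\sum_(a in A | a \notin C) 'C(#|(A :\ a) :&: C|, r) =
   \sum_(a in A :\: C) 'C(#|A :&: C|, r))%N.
  apply: eq_big => [a|a /andP[aA aC]]; first by rewrite inE andbC.
  congr ('C(#|pred_of_set _|, _)); apply/setP=> x; rewrite !inE -andbA.
  by case: eqP => //= ->; rewrite (negPf aC) andbF.
rewrite !sum_nat_const mul_bin_down -mulnDl.
case: (leqP r #|A :&: C|) => [rt|tr]; last by rewrite bin_small ?muln0.
by congr (_ * _)%N; rewrite -(cardsID C A); lia.
Qed.

(** Marks an edge of a matching: one of the [r] picked as diagonal, or one of the [j + 1 - r] free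
    ones, which can sit at [(k - r) ^ 2] places. *)
Lemma kcoef_rec (k j r : nat) : (0 < k)%N -> (r <= j.+1)%N ->
  (j.+1 * kcoef k j.+1 r =
   (if r is r'.+1 then r * kcoef k.-1 j r' else 0) +
   (if r <= j then (k - r) ^ 2 * kcoef k.-1 j r else 0))%N.
Proof.
case: k => // k _ rj; rewrite /kcoef /=.
have second : (r <= j)%N -> ((k.+1 - r) ^ 2 * ((j - r)`! * 'C(k - r, j - r) ^ 2)
   = (j.+1 - r) * ((j.+1 - r)`! * 'C(k.+1 - r, j.+1 - r) ^ 2))%N.
  move=> rj'; have := mul_bin_diag (k.+1 - r) (j - r).
  have -> : (k.+1 - r).-1 = (k - r)%N by lia.
  rewrite (subSn rj') factS; set a := (k.+1 - r)%N; set b := 'C(_, _).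
  set c := 'C(_, _) => E.
  rewrite mulnCA -expnMn E; ring.
case: r rj second => [|r] rj second.
  by rewrite second // !subn0 add0n.
rewrite !subSS.
case: (leqP r.+1 j) => h; last first.
  have -> : r = j by lia.
  by rewrite subnn; lia.
rewrite (second h) !subSS -mulnDl; congr (_ * _)%N; lia.
Qed.

Section Gram.
Context {R : realFieldType} (n : nat) (e : R) (ne1 : n%:R * e = 1).

(** Coordinate [x] of the basis vector of [a], projected orthogonally to the all-ones vector. *)
Let delta (x a : 'I_n) : R := (a == x)%:R - e.

Let delta_gram (a b : 'I_n) : \sum_x delta x a * delta x b = (a == b)%:R - e.
Proof.
under eq_bigr do rewrite mulrBl !mulrBr opprB.
rewrite big_split /= !sumrB sumr_const card_ord -mulr_suml.
rewrite (bigD1 a) //= eqxx mul1r big1 ?addr0; last first.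
  by move=> i /negPf; rewrite eq_sym => ->; rewrite mul0r.
have S c : \sum_x (c == x :> 'I_n)%:R = 1 :> R.
  rewrite (bigD1 c) //= eqxx big1 ?addr0 //.
  by move=> i /negPf; rewrite eq_sym => ->.
rewrite -mulr_sumr !S -(mulr_natl (e * e)) mulrA ne1 eq_sym; ring.
Qed.

(** Removes a marked edge ab from a matching of size [j + 1], which has [j + 1] edges to mark. *)
Let kern_step (k j : nat) (A B : {set 'I_n}) : #|A| = k -> #|B| = k ->
  \sum_(a in A) \sum_(b in B) ((a == b)%:R - e)
     * kern e k.-1 j #|(A :\ a) :&: (B :\ b)|
  = j.+1%:R * kern e k j.+1 #|A :&: B|.
Proof.
move=> Ak Bk; case: (posnP k) => [k0|k_gt0].
  move: Ak Bk; rewrite k0 => /eqP; rewrite cards_eq0 => /eqP-> _.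
  rewrite big_set0 set0I cards0 /kern big1 ?mulr0 // => -[r rj] _ /=.
  by case: r rj => [|r] rj; rewrite ?mul0r // /kcoef !subn0 bin0n muln0 mul0r.
set t := #|A :&: B|.
transitivity (\sum_(r < j.+1) (kcoef k.-1 j r)%:R * (- e) ^+ (j - r) *
   \sum_(a in A) \sum_(b in B) ((a == b)%:R - e) *
     ('C(#|(A :\ a) :&: (B :\ b)|, r))%:R).
  under [RHS]eq_bigr do rewrite mulr_sumr.
  rewrite [RHS]exchange_big; apply: eq_bigr => a _ /=.
  under [RHS]eq_bigr do rewrite mulr_sumr.
  rewrite [RHS]exchange_big; apply: eq_bigr => b _ /=.
  rewrite /kern mulr_sumr; apply: eq_bigr => r _.
  by rewrite natrM; ring.
(* The diagonal pairs give [t * 'C(t.-1, r)]; the constant [- e] is summed over all pairs by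
   [sum_bin_setD1], once in [B] and once in [A]. *)
have inner r : \sum_(a in A) \sum_(b in B) ((a == b)%:R - e) *
     ('C(#|(A :\ a) :&: (B :\ b)|, r))%:R
   = (r.+1 * 'C(t, r.+1))%:R - e * ((k - r) ^ 2 * 'C(t, r))%:R.
  under eq_bigr do (under eq_bigr do rewrite mulrBl; rewrite sumrB).
  rewrite sumrB; congr (_ - _).
    rewrite (bigID (mem B)) /= [X in _ + X]big1 ?addr0; last first.
      move=> a /andP[aA aB]; rewrite big1 // => b bB.
      by case: eqP => [E|]; rewrite ?mul0r //; rewrite E bB in aB.
    under eq_bigl do rewrite -in_setI.
    transitivity (\sum_(a in A :&: B) ('C(t.-1, r))%:R : R).
      apply: eq_bigr => a; rewrite inE => /andP[aA aB].
      rewrite (bigD1 a) //= eqxx mul1r big1 ?addr0; last first.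
        by move=> b /andP[_ /negPf]; rewrite eq_sym => ->; rewrite mul0r.
      rewrite /t (cardsD1 a (A :&: B)) inE aA aB /=.
      congr ('C(#|pred_of_set _|, _)%:R); apply/setP=> x; rewrite !inE.
      by case: eqP.
    by rewrite sumr_const -[LHS]mulr_natl -natrM mul_bin_diag.
  under eq_bigr do rewrite -mulr_sumr.
  rewrite -mulr_sumr; congr (_ * _).
  under eq_bigr do rewrite -natr_sum.
  rewrite -natr_sum; congr (_%:R).
  transitivity (\sum_(a in A) (k - r) * 'C(#|(A :\ a) :&: B|, r))%N.
    apply: eq_bigr => a _; under eq_bigr do rewrite setIC.
    by rewrite sum_bin_setD1 Bk setIC.
  by rewrite -big_distrr /= sum_bin_setD1 Ak mulnA.
under eq_bigr do rewrite inner.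
rewrite /kern mulr_sumr.
transitivity (\sum_(r < j.+2) (
  ((if val r is r'.+1 then r * kcoef k.-1 j r' else 0) +
   (if r <= j then (k - r) ^ 2 * kcoef k.-1 j r else 0))%N)%:R *
   'C(t, r)%:R * (- e) ^+ (j.+1 - r) : R); last first.
  apply: eq_bigr => r _; rewrite -kcoef_rec //; last by rewrite -ltnS.
  by rewrite !natrM; ring.
under [RHS]eq_bigr do rewrite natrD 2!mulrDl.
rewrite [RHS]big_split /= [X in _ = X + _]big_ord_recl /= !mul0r add0r.
rewrite [X in _ = _ + X]big_ord_recr /= ltnn !mul0r addr0 -big_split /=.
apply: eq_bigr => -[r /= rj] _; rewrite -ltnS rj subSS /bump /= add1n.
rewrite subSn -1?ltnS // exprS !natrM; ring.
Qed.

(* The Gram vectors of level [j] are the symmetrised tensors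
   [\sum_(i_1 .. i_j distinct in A) (x_(i_1) - e * 1) (x) .. (x) (x_(i_j) - e * 1)],
   built here by splitting off one tensor factor at a time. *)
Lemma kern_gram (j : nat) : exists (I : finType) (g : I -> {set 'I_n} -> R),
  forall (k : nat) (A B : {set 'I_n}), #|A| = k -> #|B| = k ->
    \sum_i g i A * g i B = j`!%:R * kern e k j #|A :&: B|.
Proof.
elim: j => [|j [I [g gE]]].
  exists unit, (fun _ _ => 1) => k A B _ _.
  rewrite big_const card_unit /= addr0 /kern big_ord1 /=.
  by rewrite bin0 /kcoef bin0 expr0 !mulr1.
exists ('I_n * I)%type,
  (fun x (A : {set 'I_n}) => \sum_(a in A) delta x.1 a * g x.2 (A :\ a)) => k A B Ak Bk.
rewrite factS natrM mulrAC -kern_step // mulr_suml.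
transitivity (\sum_(a in A) \sum_(b in B) (\sum_x delta x a * delta x b) *
    \sum_i g i (A :\ a) * g i (B :\ b)).
  rewrite -(pair_bigA _ (fun x i => (\sum_(a in A) delta x a * g i (A :\ a)) *
     (\sum_(a in B) delta x a * g i (B :\ a)))) /=.
  under eq_bigr => x _ do under eq_bigr => i _ do rewrite mulr_suml.
  under eq_bigr => x _ do rewrite exchange_big.
  rewrite exchange_big; apply: eq_bigr => a _ /=.
  under eq_bigr => x _ do under eq_bigr => i _ do rewrite mulr_sumr.
  under eq_bigr => x _ do rewrite exchange_big.
  rewrite exchange_big; apply: eq_bigr => b _ /=.
  rewrite mulr_suml; apply: eq_bigr => x _; rewrite mulr_sumr.
  by apply: eq_bigr => i _; ring.
apply: eq_bigr => a aA; rewrite mulr_suml; apply: eq_bigr => b bB.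
rewrite delta_gram (gE k.-1); first by ring.
  by rewrite -Ak (cardsD1 a A) aA.
by rewrite -Bk (cardsD1 b B) bB.
Qed.

End Gram.

(** * The limit system *)

Definition rank (P : pred nat) (t : nat) : nat := count P (iota 0 t).

(* Length of the run of consecutive elements of [P] below [k] that starts at [t];
   0 if [P t] fails. *)
Definition run_from (P : pred nat) (k t : nat) : nat :=
  find (predC P) (iota t (k - t)).

(* The point following the last element of [P] below [t], or 0. *)
Fixpoint gap_start (P : pred nat) (t : nat) : nat :=
  if t is t'.+1 then (if P t' then t else gap_start P t') else 0.

(* Ratio at [t+1] and [t] of the leading coefficient in [n] of the part of [F]
   coming from the levels up to the current point. *)
Definition growth (R : realFieldType) (P : pred nat) (k t : nat) : R :=
  if P t then (run_from P k t)%:R / (k - t)%:R ^+ 2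
  else t.+1%:R / (t.+1 - gap_start P t)%:R.

Definition theta_coef (R : realFieldType) (P : pred nat) (k t : nat) : R :=
  \prod_(i < t) growth R P k i.

Section Masks.
Variable P : pred nat.

Lemma rankD t i : rank P (t + i) = (rank P t + count P (iota t i))%N.
Proof. by rewrite /rank iotaD count_cat. Qed.

Lemma rankS t : rank P t.+1 = (rank P t + P t)%N.
Proof. by rewrite -addn1 rankD /= addn0. Qed.

Lemma rank_le t i : (t <= i)%N -> (rank P t <= rank P i)%N.
Proof. by move=> /subnKC <-; rewrite rankD leq_addr. Qed.

Lemma rank_leD t i : (t <= i)%N -> (rank P i <= rank P t + (i - t))%N.
Proof.
move=> ti; rewrite -{1}(subnKC ti) rankD leq_add2l.
by rewrite (leq_trans (count_size _ _)) // size_iota.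
Qed.

Lemma run_fromE k t : (t < k)%N -> run_from P k t = if P t then (run_from P k t.+1).+1 else 0%N.
Proof.
move=> tk; rewrite /run_from; have -> : (k - t = (k - t.+1).+1)%N by lia.
by rewrite /=; case: (P t).
Qed.

Lemma run_from_out k t : (k <= t)%N -> run_from P k t = 0%N.
Proof. by rewrite /run_from -subn_eq0 => /eqP ->. Qed.

Lemma run_from_le k t : (run_from P k t <= k - t)%N.
Proof. by rewrite -[X in (_ <= X)%N](size_iota t) find_size. Qed.

Lemma leq_run_from k t i : (t + i <= k)%N -> (i <= run_from P k t)%N = (count P (iota t i) == i).
Proof.
elim: i t => [|i IH] t tik //=.
rewrite run_fromE; last by lia.
case Pt: (P t) => /=; last first.
  by rewrite add0n; have := count_size P (iota t.+1 i); rewrite size_iota; lia.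
by rewrite ltnS add1n eqSS IH //; lia.
Qed.

Lemma gap_start_le t : (gap_start P t <= t)%N.
Proof. by elim: t => //= t IH; case: (P t) => //; lia. Qed.

(** Call 0 and the successors of elements of [P] active. Exactly one active [j <= t] has no element
    of [P] in [j, t); among the levels up to [t], it alone will survive in the limit row at [t]. *)
Lemma gap_startP t j : (j <= t)%N ->
  ((j == 0) || P j.-1) && (rank P j == rank P t) = (j == gap_start P t).
Proof.
elim: t j => [|t IH] j; first by rewrite leqn0 => /eqP->.
rewrite leq_eqVlt => /orP[/eqP->|].
  rewrite eqxx andbT /=; case: (P t); first by rewrite eqxx.
  by have := gap_start_le t; lia.
rewrite ltnS /= rankS => jt; case: (P t) => /=; last by rewrite addn0 IH.
by have := rank_le _ _ jt; lia.
Qed.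

End Masks.

Section Limit.
Context {R : realFieldType} (P : pred nat) (k : nat).

(* [kern] with [- e] split as [(-1) * 'X] and rescaled by [n ^ (rank t - rank j)].
   The exponent truncates only when [t < r], where the binomial is 0. *)
Definition rowp (t j : nat) : {poly R} :=
  \sum_(r < j.+1) (('C(t, r) * kcoef k j r)%:R * (-1) ^+ (j - r))
     *: 'X^(j - r + rank P t - rank P j).

Lemma rowp_eval (n e : R) (t j : nat) : n * e = 1 ->
  (rowp t j).[e] * n ^+ rank P t = n ^+ rank P j * kern e k j t.
Proof.
move=> ne; rewrite /rowp horner_sum mulr_suml mulr_sumr.
apply: eq_bigr => -[r /= rj] _; rewrite hornerZ hornerXn.
case: (leqP r t) => [rt|/bin_small ->]; last by rewrite mul0n !mul0r mulr0.
set a := (j - r + rank P t - rank P j)%N.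
have aE : (a + rank P j = j - r + rank P t)%N.
  rewrite /a subnK //; case: (leqP t j) => tj.
    by have := rank_leD P _ _ tj; lia.
  by have := rank_le P _ _ (ltnW tj); lia.
have key : e ^+ a * n ^+ rank P t = n ^+ rank P j * e ^+ (j - r).
  have one m : e ^+ m * n ^+ m = 1 by rewrite -exprMn mulrC ne expr1n.
  rewrite -[LHS]mulr1 -(one (rank P j)) mulrACA -exprD aE exprD.
  rewrite -[RHS]mulr1 -(one (rank P t)).
  move: (e ^+ (j - r)) (e ^+ rank P t) (n ^+ rank P t) (n ^+ rank P j) => *.
  ring.
rewrite -mulrA key (exprNn e).
move: (e ^+ (j - r)) (n ^+ rank P j) ((-1) ^+ (j - r)) => *; ring.
Qed.

Lemma kcoef_diag j : kcoef k j j = 1%N.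
Proof. by rewrite /kcoef subnn bin0. Qed.

Lemma rowp0_le (t j : nat) : (j <= t)%N ->
  (rowp t j).[0] = if rank P j == rank P t then 'C(t, j)%:R else 0.
Proof.
move=> jt; rewrite /rowp horner_sum big_ord_recr /= big1 ?add0r; last first.
  move=> [r /= rj] _; rewrite hornerZ hornerXn expr0n.
  have := rank_le P _ _ jt; case: eqP => [|_ _]; last by rewrite mulr0.
  lia.
rewrite hornerZ hornerXn kcoef_diag subnn expr0n muln1 expr0 mulr1 add0n.
have -> : (rank P t - rank P j == 0)%N = (rank P j == rank P t).
  by have := rank_le P _ _ jt; lia.
by case: eqP; rewrite ?mulr0 ?mulr1.
Qed.

(** For [r <= t] the exponent is [t - r] plus the number of points of [t, t + i) outside [P]; it is
    0 only if [r = t] and the whole interval lies in [P]. *)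
Lemma rowp0_gt (t i : nat) : (t + i <= k)%N -> (0 < i)%N ->
  (rowp t (t + i)).[0] = if (i <= run_from P k t)%N then (-1) ^+ i * (kcoef k (t + i) t)%:R else 0.
Proof.
move=> tik i0; rewrite /rowp horner_sum.
have tj : (t < (t + i).+1)%N by lia.
rewrite (bigD1 (Ordinal tj)) //= big1 ?addr0; last first.
  move=> [r /= rj] /negP; rewrite -val_eqE /= => rt; rewrite hornerZ hornerXn expr0n.
  case: (ltnP t r) => [/bin_small->|rt']; first by rewrite mul0n !mul0r.
  case: eqP => [|_]; last by rewrite mulr0.
  by have := rank_leD P _ _ (leq_addr i t); lia.
rewrite hornerZ hornerXn expr0n addKn binn mul1n leq_run_from // rankD.
have := count_size P (iota t i); rewrite size_iota => ci.
have -> : (i + rank P t - (rank P t + count P (iota t i)) == 0)%N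
    = (count P (iota t i) == i) by lia.
by case: eqP; rewrite ?mulr0 ?mulr1 1?mulrC.
Qed.

(** Hence dividing the unknown of each level s by the square of (k - s)! turns the coefficients
    along a run into [(-1) ^+ i / i!]. *)
Lemma kcoefE t i : (t + i <= k)%N ->
  (kcoef k (t + i) t)%:R * ((k - (t + i))`!)%:R ^+ 2 * i`!%:R = ((k - t)`!)%:R ^+ 2 :> R.
Proof.
move=> tik; rewrite /kcoef addKn -!natrX -!natrM; congr (_%:R).
have := @bin_fact (k - t) i; rewrite -subnDA => <-; last by lia.
ring.
Qed.

(** The rows say that the series with coefficients [g (m - i)], times exp (- z), is constant up to
    degree [m]; so the series is [g m] times exp z. *)
Lemma alternating_exp (m : nat) (g : nat -> R) :
  (forall p, (p < m)%N ->
    \sum_(i < (m - p).+1) (-1) ^+ i * g (p + i)%N / i`!%:R = 0) ->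
  forall i, (i <= m)%N -> g (m - i)%N = g m / i`!%:R.
Proof.
move=> row; elim/ltn_ind => i IH im.
case: (posnP i) => [->|i0]; first by rewrite subn0 divr1.
have fact_n0 j : j`!%:R != 0 :> R by rewrite pnatr_eq0 -lt0n fact_gt0.
have := row (m - i)%N; rewrite subKn // => /(_ _)/wrap[]; first by lia.
(* The claimed values satisfy the same row, by expanding [(1 - 1) ^+ i]; by induction the two rows
   agree in all terms but the first. *)
have binom0 : \sum_(j < i.+1) (-1) ^+ j * (g m / (i - j)`!%:R) / j`!%:R = 0.
  transitivity (g m / i`!%:R * (1 - 1) ^+ i); last first.
    by rewrite subrr expr0n; case: i i0 {IH im} => // i _; rewrite mulr0.
  rewrite exprBn mulr_sumr; apply: eq_bigr => j _.
  have := @bin_fact i j; rewrite -ltnS ltn_ord => /(_ isT) <-.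
  rewrite expr1n !expr1n mulr1 -mulr_natl !natrM.
  have b0 : ('C(i, j))%:R != 0 :> R by rewrite pnatr_eq0 -lt0n bin_gt0 -ltnS.
  by field; rewrite !fact_n0 b0.
rewrite -{2}binom0 !big_ord_recl /= !expr0 !mul1r addn0 subn0 !divr1.
set s1 := \sum_(_ < _) _; set s2 := \sum_(_ < _) _ => E.
have E12 : s1 = s2.
  apply: eq_bigr => -[j /= ji] _; rewrite /bump /= add1n.
  have -> : (m - i + j.+1 = m - (i - j.+1))%N by lia.
  by rewrite IH //; lia.
by move: E; rewrite E12 => /addIr.
Qed.

End Limit.

Lemma theta_coefS (R : realFieldType) P k t :
  theta_coef R P k t.+1 = theta_coef R P k t * growth R P k t.
Proof. by rewrite /theta_coef big_ord_recr. Qed.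

Lemma growth_gt0 (R : realFieldType) P k t : (t < k)%N -> 0 < growth R P k t.
Proof.
move=> tk; rewrite /growth; case: ifP => Pt; last first.
  by rewrite divr_gt0 // ltr0n subn_gt0 ltnS gap_start_le.
by rewrite divr_gt0 ?exprn_gt0 ?ltr0n ?subn_gt0 // run_fromE // Pt.
Qed.

Lemma theta_coef_gt0 (R : realFieldType) P k t : (t <= k)%N -> 0 < theta_coef R P k t.
Proof.
move=> tk; apply: prodr_gt0 => -[i /= it] _.
by apply: growth_gt0; apply: leq_trans tk.
Qed.

Section LimitSystem.
Context {R : realFieldType} (P : pred nat) (k : nat) (w : nat -> R).
Hypothesis w_supp : forall t, (t < k)%N -> ~~ P t -> w t.+1 = 0.

(** What the levels up to [t] contribute to the limit row at [t]. *)
Let W t := w (gap_start P t) * ('C(t, gap_start P t))%:R.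

Let W_active j : (j == 0%N) || P j.-1 -> W j = w j.
Proof.
move=> aj; have := gap_startP P j j (leqnn j); rewrite aj eqxx /= => /esym/eqP yj.
by rewrite /W -yj binn mulr1.
Qed.

(** Up to [t], only the level [gap_start P t] is both active and of the same rank as [t]; above [t],
    only the levels reached by the run starting at [t] survive. *)
Lemma limit_row t : (t <= k)%N ->
  \sum_(j < k.+1) w j * (rowp P k t j : {poly R}).[0] =
  W t + \sum_(i < run_from P k t)
     w (t + i.+1)%N * ((-1) ^+ i.+1 * (kcoef k (t + i.+1) t)%:R).
Proof.
move=> tk; rewrite -(big_mkord xpredT (fun j => w j * (rowp P k t j).[0])).
rewrite (@big_cat_nat _ _ _ t.+1) //=; congr (_ + _).
  rewrite big_mkord; have yt := gap_start_le P t.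
  have yt' : (gap_start P t < t.+1)%N by rewrite ltnS.
  rewrite (bigD1 (Ordinal yt')) //= big1 ?addr0; last first.
    move=> [j /= jt] /negP; rewrite -val_eqE /= => jy.
    rewrite rowp0_le // -?ltnS //; case: ifP => rj; last by rewrite mulr0.
    have := gap_startP P t j; rewrite rj andbT -ltnS => /(_ jt) aj.
    case: j jt jy rj aj => [|j] jt jy rj aj; first by rewrite -aj in jy.
    by rewrite w_supp ?mul0r //; [lia | rewrite /= in aj; rewrite aj; exact/negP].
  rewrite rowp0_le //; have := gap_startP P t _ yt.
  by rewrite eqxx => /andP[_ ->].
rewrite -{1}[t.+1]add0n big_addn big_mkord subSS.
rewrite (big_ord_widen (k - t) (fun i => w (t + i.+1)%N *
   ((-1) ^+ i.+1 * (kcoef k (t + i.+1) t)%:R))) ?run_from_le //.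
rewrite [RHS]big_mkcond; apply: eq_bigr => -[i /= ik] _.
rewrite addnC addSnnS rowp0_gt //; last by lia.
by case: ifP => _; rewrite ?mulr0.
Qed.

Hypothesis rows0 : forall t, (t < k)%N -> P t ->
  \sum_(j < k.+1) w j * (rowp P k t j : {poly R}).[0] = 0.

Let fact_n0 j : j`!%:R != 0 :> R.
Proof. by rewrite pnatr_eq0 -lt0n fact_gt0. Qed.

(* Along a run [t, t+1, .., t+m] the rows form a triangular Toeplitz system with
   generating series [exp (- z)]. *)
Let W_step t : (t < k)%N -> P t -> W t.+1 = W t * ((run_from P k t)%:R / (k - t)%:R ^+ 2).
Proof.
move=> tk Pt; set m := run_from P k t.
have m0 : (0 < m)%N by rewrite /m run_fromE // Pt.
have mk : (m <= k - t)%N := run_from_le P k t.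
pose g p := W (t + p)%N / ((k - (t + p))`!)%:R ^+ 2.
have PT i : (i < m)%N -> P (t + i)%N.
  move=> im; have := @leq_run_from P k t i.+1; rewrite im => /(_ _)/wrap[]; first by lia.
  rewrite -addn1 iotaD count_cat /= addn0 => /esym/eqP.
  have := count_size P (iota t i); rewrite size_iota.
  by case: (P _) => //; lia.
have uplD i : (i <= m)%N -> run_from P k (t + i) = (m - i)%N.
  elim: i => [|i IH] im; first by rewrite addn0 subn0.
  have := IH (ltnW im); rewrite run_fromE ?PT //; last by lia.
  by rewrite addnS; lia.
have alt := @alternating_exp R m g.
have : g 1%N = g 0%N * m%:R.
  have g_fact : forall i, (i <= m)%N -> g (m - i)%N = g m / i`!%:R.
    apply: alt => p pm.
    have := rows0 (t + p)%N; rewrite PT // => /(_ _ isT)/wrap[]; first by lia.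
    rewrite limit_row ?uplD; [|lia|lia] => row.
    rewrite big_ord_recl expr0 mul1r addn0 divr1.
    have kn0 : ((k - (t + p))`!)%:R ^+ 2 != 0 :> R by rewrite expf_neq0.
    apply: (mulIf kn0); rewrite mul0r -[RHS]row mulrDl; congr (_ + _).
      by rewrite /g divfK.
    rewrite mulr_suml; apply: eq_bigr => -[i /= im] _; rewrite /bump /= add1n.
    have ipm : (p + i.+1 <= m)%N by lia.
    have a1 : (t + p + i.+1 <= k)%N by lia.
    (* Points that follow an element of the run are active, so [W] is [w] there. *)
    rewrite /g -(kcoefE _ _ _ a1) addnA W_active; last first.
      by rewrite addnS /= -addnA PT //; lia.
    by field; rewrite !fact_n0.
  (* Indices [m] and [m - 1] express [g 0] and [g 1] through [g m], with ratio [m]. *)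
  have := g_fact m.-1 (leq_pred m); have := g_fact m (leqnn m).
  rewrite subnn => ->; have -> : (m - m.-1 = 1)%N by lia.
  have -> : m`!%:R = m%:R * (m.-1)`!%:R :> R.
    by rewrite -natrM -{1}(prednK m0) factS (prednK m0).
  move=> ->.
  by field; rewrite fact_n0 pnatr_eq0 -lt0n m0.
rewrite /g addn1 addn0 => E.
have -> : W t.+1 = W t.+1 / (k - t.+1)`!%:R ^+ 2 * (k - t.+1)`!%:R ^+ 2.
  by rewrite divfK // expf_neq0.
rewrite E; have -> : (k - t = (k - t.+1).+1)%N by lia.
rewrite factS natrM; field.
by rewrite fact_n0 nat1r pnatr_eq0.
Qed.

Lemma limit_solution t : (t <= k)%N -> W t = w 0%N * theta_coef R P k t.
Proof.
elim: t => [|t IH] tk; first by rewrite /W /= mulr1 /theta_coef big_ord0 mulr1.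
rewrite theta_coefS mulrA -IH ?(ltnW tk) // /growth.
case: ifP => Pt; first exact: W_step.
(* Off [P] the gap start [y] does not move, and the growth is the ratio of ['C(t.+1, y)] to
   ['C(t, y)]. *)
rewrite /W /= Pt; set y := gap_start P t.
have yt : (y <= t)%N := gap_start_le P t.
have n0 : (t.+1 - y)%:R != 0 :> R by rewrite pnatr_eq0; lia.
apply: (mulIf n0); rewrite -!mulrA mulVf // mulr1; congr (_ * _).
by rewrite -!natrM; congr (_%:R); have := mul_bin_down t.+1 y; rewrite /=; lia.
Qed.

Lemma limit_coef j : (j <= k)%N -> (j == 0%N) || P j.-1 ->
  w j = w 0%N * theta_coef R P k j.
Proof. by move=> jk aj; rewrite -limit_solution // W_active. Qed.

Lemma limit_value :
  \sum_(j < k.+1) w j * (rowp P k k j : {poly R}).[0] = w 0%N * theta_coef R P k k.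
Proof. by rewrite limit_row // run_from_out // big_ord0 addr0 limit_solution. Qed.

End LimitSystem.

(** * Solving the system for large n *)

Section NearZero.
Context {R : realFieldType}.
Implicit Types (p d : {poly R}) (e : R).

Lemma poly_bounded01 p : exists2 B : R, 0 <= B & forall e, 0 <= e <= 1 -> `|p.[e]| <= B.
Proof.
elim/poly_ind: p => [|p c [B B0 pB]].
  by exists 0 => // e _; rewrite horner0 normr0.
exists (B + `|c|) => [|e e01]; first by rewrite addr_ge0.
rewrite hornerMXaddC (le_trans (ler_normD _ _)) // lerD2r normrM.
have /andP[e0 e1] := e01; rewrite (ger0_norm e0) -[B]mulr1.
by rewrite ler_pM ?pB.
Qed.

Lemma poly_lipschitz0 p :
  exists2 C : R, 0 <= C & forall e, 0 <= e <= 1 -> `|p.[e] - p.[0]| <= C * e.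
Proof.
elim/poly_ind: p => [|p c _].
  by exists 0 => // e _; rewrite !horner0 subrr normr0 mul0r.
have [B B0 pB] := poly_bounded01 p; exists B => // e e01.
rewrite !hornerMXaddC mulr0 add0r addrK normrM; have /andP[e0 _] := e01.
by rewrite (ger0_norm e0) ler_wpM2r // pB.
Qed.

Lemma ratio_lipschitz0 p d : d.[0] != 0 -> exists delta C : R, [/\ 0 < delta, 0 <= C &
  forall e, 0 <= e <= delta ->
    d.[e] != 0 /\ `|p.[e] / d.[e] - p.[0] / d.[0]| <= C * e].
Proof.
move=> d0; have [C1 C1_0 dC] := poly_lipschitz0 d.
have [C2 C2_0 qC] := poly_lipschitz0 (d.[0] *: p - p.[0] *: d).
have a0 : 0 < `|d.[0]| by rewrite normr_gt0.
set a := `|d.[0]| in a0.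
(* The bound on [e] keeps [|d(e)| >= a / 2]. The difference of the quotients has numerator at most
   [C2 * e] and denominator at least [a ^+ 2 / 2]. *)
exists (Num.min 1 (a / (2 * (C1 + 1)))), (2 * C2 / a ^+ 2); split.
- by rewrite lt_min ltr01 divr_gt0 // mulr_gt0 // ltr_wpDl.
- by rewrite divr_ge0 ?exprn_ge0 ?mulr_ge0 // ltW.
move=> e; rewrite le_min => /and3P[e0 e1 ea].
have e01 : 0 <= e <= 1 by rewrite e0.
have C1p : 0 < C1 + 1 by rewrite ltr_wpDl.
have da : a / 2 <= `|d.[e]|.
  have := dC e e01; rewrite distrC => h.
  have : C1 * e <= a / 2.
    move: ea; rewrite ler_pdivlMr ?mulr_gt0 // => ea.
    rewrite ler_pdivlMr //; nra.
  have := ler_normD (d.[0] - d.[e]) d.[e]; rewrite subrK -/a; lra.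
have de0 : d.[e] != 0 by rewrite -normr_gt0; lra.
split => //.
have -> : p.[e] / d.[e] - p.[0] / d.[0] =
    ((d.[0] *: p - p.[0] *: d).[e] - (d.[0] *: p - p.[0] *: d).[0])
    / (d.[0] * d.[e]).
  by rewrite !hornerE; field; rewrite d0 de0.
rewrite normrM normfV normrM -/a ler_pdivrMr ?mulr_gt0 ?normr_gt0 //.
apply: le_trans (qC e e01) _.
rewrite -[leLHS]mulr1 -[2 * C2 / a ^+ 2 * e * _]/(2 * C2 / a ^+ 2 * e * (a * `|d.[e]|)).
have -> : 2 * C2 / a ^+ 2 * e * (a * `|d.[e]|) = C2 * e * (`|d.[e]| / (a / 2)).
  by field; rewrite gt_eqF.
rewrite ler_wpM2l ?mulr_ge0 // ler_pdivlMr ?divr_gt0 //; lra.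
Qed.

Lemma ratio_ge0 p d : d.[0] != 0 -> 0 < p.[0] / d.[0] ->
  exists2 delta : R, 0 < delta & forall e, 0 <= e <= delta -> 0 <= p.[e] / d.[e].
Proof.
move=> d0 v0; have [delta [C [delta0 C0 H]]] := ratio_lipschitz0 p d d0.
set v := p.[0] / d.[0] in v0 H.
exists (Num.min delta (v / (C + 1))).
  by rewrite lt_min delta0 divr_gt0 // ltr_wpDl.
move=> e; rewrite le_min => /and3P[e0 ed ev].
have [|_] := H e; first by rewrite e0.
rewrite ler_distl; move: ev; rewrite ler_pdivlMr ?ltr_wpDl // => ev.
by move=> /andP[h _]; nra.
Qed.

End NearZero.

Section Weights.
Context {R : realType} (P : pred nat) (k : nat).

(* Row [0] normalises [w 0 = 1], row [t.+1] is the equation at [t] if [t] lies in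
   [P], and otherwise kills the unused level [t.+1]. *)
Let M : 'M[{poly R}]_k.+1 := \matrix_(i, j)
  if val i is t.+1 then (if P t then rowp P k t j else (i == j)%:R) else (i == j)%:R.

Let MP (e : R) (w : nat -> R) :
  (forall i : 'I_k.+1, (0 < i)%N -> \sum_(j < k.+1) w j * (M i j).[e] = 0) ->
   (forall t, (t < k)%N -> ~~ P t -> w t.+1 = 0) /\
   (forall t, (t < k)%N -> P t -> \sum_(j < k.+1) w j * (rowp P k t j : {poly R}).[e] = 0).
Proof.
move=> Mw; split=> t tk Pt; have := Mw (Ordinal (tk : (t.+1 < k.+1)%N)) isT.
  rewrite (bigD1 (Ordinal (tk : (t.+1 < k.+1)%N))) //= !mxE /= (negPf Pt) eqxx hornerC mulr1.
  rewrite big1 ?addr0 // => j /negPf; rewrite eq_sym mxE /= (negPf Pt) => ->.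
  by rewrite horner0 mulr0.
by under eq_bigr do rewrite mxE /= Pt.
Qed.

Let M0 (w : nat -> R) e : \sum_(j < k.+1) w j * (M ord0 j).[e] = w 0%N.
Proof.
rewrite (bigD1 ord0) //= !mxE /= hornerC mulr1 big1 ?addr0 // => j /negPf.
by rewrite eq_sym mxE /= => ->; rewrite horner0 mulr0.
Qed.

(** A kernel vector solves the limit system with [w 0 = 0], and [limit_coef] makes every active
    level a multiple of [w 0]. *)
Lemma det_system0_neq0 : (\det M).[0] != 0.
Proof.
rewrite -horner_evalE -det_map_mx -det_tr; apply/det0P => -[v v0 vM].
pose w j := v 0 (inord j).
have wM (i : 'I_k.+1) : \sum_(j < k.+1) w j * (M i j).[0] = 0.
  move/rowP: vM => /(_ i); rewrite !mxE => vi; rewrite -[RHS]vi; apply: eq_bigr => j _.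
  by rewrite /w inord_val [_^T _ _]mxE [map_mx _ _ _ _]mxE.
have [supp rows] := MP 0 w (fun i _ => wM i).
have w00 : w 0%N = 0 by rewrite -(M0 w 0) wM.
case/eqP: v0; apply/rowP => j; rewrite mxE -(inord_val j) -/(w j).
have jk : (j <= k)%N by rewrite -ltnS.
have [aj|] := boolP (((j : nat) == 0%N) || P j.-1).
  by rewrite (limit_coef _ _ _ supp rows) // w00 mul0r.
by case: (nat_of_ord j) jk => // t tk /= ?; rewrite supp.
Qed.

(** Cramer's rule: the adjugate gives the solution as quotients of polynomials in [e] with one
    denominator. *)
Let num j : {poly R} := (\adj M) (inord j) ord0.

Let w e j : R := (num j).[e] / (\det M).[e].

Let num_sol e : (\det M).[e] != 0 ->
  [/\ w e 0%N = 1, (forall t, (t < k)%N -> ~~ P t -> w e t.+1 = 0) &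
   (forall t, (t < k)%N -> P t ->
      \sum_(j < k.+1) w e j * (rowp P k t j : {poly R}).[e] = 0)].
Proof.
move=> d0.
have wM (i : 'I_k.+1) : \sum_(j < k.+1) w e j * (M i j).[e] = (i == ord0)%:R.
  have /matrixP/(_ i ord0) := mul_mx_adj M; rewrite !mxE => E.
  transitivity ((\sum_j M i j * (\adj M) j ord0).[e] / (\det M).[e]).
    rewrite horner_sum mulr_suml; apply: eq_bigr => j _.
    by rewrite /w /num inord_val hornerM; ring.
  by rewrite E hornerMn; case: eqP; rewrite ?mulr0n ?mul0r // divff.
have [|supp rows] := MP e (w e).
  by move=> i i0; rewrite wM; case: eqP i0 => // ->.
by split=> //; rewrite -(M0 (w e) e) wM.
Qed.

Lemma inv_nat_small (delta : R) : 0 < delta ->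
  exists N, forall n, (N <= n)%N -> (0 < n)%N && (n%:R^-1 <= delta).
Proof.
move=> d0; exists (Num.bound delta^-1) => n Nn.
have := archi_boundP (ltW (_ : 0 < delta^-1)); rewrite invr_gt0 => /(_ d0) b.
have dn : delta^-1 < n%:R by rewrite (lt_le_trans b) // ler_nat.
have n0 : 0 < n%:R :> R by rewrite (lt_trans _ dn) ?invr_gt0.
by rewrite -(ltr0n R) n0 /= invf_ple ?posrE // ltW.
Qed.

Lemma dual_weights : exists (C : R) (N : nat), forall n, (N <= n)%N ->
  exists u : nat -> R, [/\ u 0%N = 1,
    forall j, (j <= k)%N -> 0 <= u j,
    forall t, (t < k)%N -> P t -> \sum_(j < k.+1) u j * kern n%:R^-1 k j t = 0 &
    `|\sum_(j < k.+1) u j * kern n%:R^-1 k j k - theta_coef R P k k * n%:R ^+ rank P k|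
      <= C * (n%:R ^+ rank P k / n%:R)].
Proof.
have D0 := det_system0_neq0.
have [w01 supp0 rows0] := num_sol 0 D0.
(* At an active level [w] has a positive limit, so it stays nonnegative near 0; at the others [w] is
   0 wherever the determinant is nonzero. *)
have pos_w : exists2 delta : R, 0 < delta & forall j, (j <= k)%N ->
    forall e, 0 <= e <= delta -> 0 <= w e j.
  (* The numerator 0 is a dummy: an interval with nonzero determinant is wanted. *)
  have [d1 [C1 [d10 _ H1]]] := ratio_lipschitz0 (0 : {poly R}) _ D0.
  suff: forall m, (m <= k.+1)%N -> exists2 delta : R, 0 < delta & forall j, (j < m)%N ->
    forall e, 0 <= e <= delta -> 0 <= w e j.
    by move=> /(_ k.+1 (leqnn _)).
  elim=> [|m IH] mk; first by exists 1.
  have [d2 d20 H2] := IH (ltnW mk).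
  suff [d3 d30 H3] : exists2 delta : R, 0 < delta &
      forall e, 0 <= e <= delta -> 0 <= w e m.
    exists (Num.min d2 d3); first by rewrite lt_min d20.
    move=> j; rewrite ltnS leq_eqVlt => /orP[/eqP->|jm] e; rewrite le_min => /and3P[e0 e2 e3].
      by apply: H3; rewrite e0.
    by apply: H2; rewrite ?e0.
  have [am|] := boolP ((m == 0%N) || P m.-1).
    apply: ratio_ge0 => //; rewrite -/(w 0 m).
    by rewrite (limit_coef _ _ _ supp0 rows0) // w01 mul1r theta_coef_gt0.
  case: m mk {IH H2} => // t tk /= Pt; exists d1 => // e /H1[de0 _].
  by have [_ -> //] := num_sol e de0.
have [d1 d10 H1] := pos_w.
pose G := \sum_(j < k.+1) num j * rowp P k k j.
have GE e : G.[e] / (\det M).[e] =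
    \sum_(j < k.+1) w e j * (rowp P k k j : {poly R}).[e].
  rewrite horner_sum mulr_suml; apply: eq_bigr => j _.
  by rewrite hornerM mulrAC.
have [d2 [C [d20 C0 H2]]] := ratio_lipschitz0 G _ D0.
have d0 : 0 < Num.min d1 d2 by rewrite lt_min d10.
have [N HN] := inv_nat_small _ d0.
exists C, N => n /HN; rewrite le_min => /and3P[n0 e1 e2].
set e := n%:R^-1 in e1 e2 *.
have e0 : 0 <= e by rewrite invr_ge0.
have ne : n%:R * e = 1 by rewrite divff // pnatr_eq0 -lt0n.
have [|de0 Gn] := H2 e; first by rewrite e0.
have [w1 supp rows] := num_sol e de0.
have FE t : \sum_(j < k.+1) n%:R ^+ rank P j * w e j * kern e k j t
   = n%:R ^+ rank P t * \sum_(j < k.+1) w e j * (rowp P k t j : {poly R}).[e].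
  rewrite mulr_sumr; apply: eq_bigr => j _.
  rewrite [RHS]mulrCA [n%:R ^+ rank P t * _]mulrC (rowp_eval _ _ _ _ _ _ ne).
  by rewrite [RHS]mulrA [w e j * _]mulrC.
(* The powers of [n] undo the rescaling built into [rowp]. *)
exists (fun j => n%:R ^+ rank P j * w e j); split.
- by rewrite w1 mulr1.
- by move=> j jk; rewrite mulr_ge0 ?exprn_ge0 // H1 // e0.
- by move=> t tk Pt; rewrite FE rows // mulr0.
rewrite FE -GE [theta_coef _ _ _ _ * _]mulrC -mulrBr normrM (ger0_norm (exprn_ge0 _ _)) //.
rewrite mulrCA ler_wpM2l ?exprn_ge0 //.
have <- : G.[0] / (\det M).[0] = theta_coef R P k k => //.
by rewrite GE (limit_value _ _ _ supp0 rows0) w01 mul1r.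
Qed.

End Weights.

(** * Feasible matrices and dual weights *)

Section Theta.
Context {R : realType} (V : finType) (adj : rel V).

(** If no matrix is feasible, [sup] defaults to 0; hence [0 <= x]. *)
Lemma lovasz_theta_le (x : R) : 0 <= x ->
  (forall B : V -> V -> R, theta_feasible adj B -> \sum_i \sum_j B i j <= x) ->
  lovasz_theta adj <= x.
Proof.
move=> x0 Bx; rewrite /lovasz_theta; set E := (X in sup X).
have [[v Ev]|E0] := pselect (nonempty E).
  by apply: ge_sup; [exists v | move=> y [B [/Bx Bx' ->]]].
by rewrite sup_out // => -[].
Qed.

(** The first hypothesis bounds the set of values, so that its [sup] is a true supremum. *)
Lemma le_lovasz_theta (x : R) (B : V -> V -> R) :
  (forall B : V -> V -> R, theta_feasible adj B -> \sum_i \sum_j B i j <= x) ->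
  theta_feasible adj B -> \sum_i \sum_j B i j <= lovasz_theta adj.
Proof.
move=> Bx FB; apply: sup_upper_bound; last by exists B.
split; first by exists (\sum_i \sum_j B i j), B.
by exists x => y [B' [/Bx Bx' ->]].
Qed.

End Theta.

Section Johnson.
Context {R : realType} (k n : nat).
Implicit Types (B : ksub n k -> ksub n k -> R).

Let psd_form B := forall x : ksub n k -> R, 0 <= \sum_i \sum_j x i * B i j * x j.
Let card_cap (A A' : ksub n k) := #|val A :&: val A'|.

Let capAA A : card_cap A A = k.
Proof. by rewrite /card_cap setIid; apply/eqP/(valP A). Qed.

Let cap_lt A A' : A != A' -> (card_cap A A' < k)%N.
Proof.
move=> AA'; have /eqP kA := valP A; have /eqP kA' := valP A'.
rewrite ltn_neqAle -{2}kA subset_leq_card ?subsetIl // andbT.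
apply: contra AA' => /eqP E; rewrite -val_eqE /=.
have sAA' : val A \subset val A'.
  by apply/setIidPl/eqP; rewrite eqEcard subsetIl -/(card_cap A A') E kA leqnn.
by rewrite eqEcard sAA' kA kA' leqnn.
Qed.

Let cap_sym A A' : card_cap A A' = card_cap A' A.
Proof. by rewrite /card_cap setIC. Qed.

(** By [kern_gram], [j!] times the pairing is a sum of values of the quadratic form of [B]. *)
Lemma kern_psd_pairing e j B : n%:R * e = 1 -> psd_form B ->
  0 <= \sum_i \sum_i' B i i' * kern e k j (card_cap i i').
Proof.
move=> ne psdB; have [I [g gE]] := @kern_gram R n e ne j.
have f0 : 0 < j`!%:R :> R by rewrite ltr0n fact_gt0.
rewrite -(pmulr_rge0 _ f0) mulr_sumr.
rewrite (_ : \sum_i _ = \sum_c \sum_i \sum_i' g c (val i) * B i i' * g c (val i')).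
  by apply: sumr_ge0 => c _; apply: psdB.
rewrite [RHS]exchange_big; apply: eq_bigr => i _; rewrite mulr_sumr.
rewrite [RHS]exchange_big; apply: eq_bigr => i' _ /=.
rewrite mulrCA -(gE k); [|exact/eqP/(valP i)|exact/eqP/(valP i')].
by rewrite mulr_sumr; apply: eq_bigr => c _; ring.
Qed.

Section Weights.
Variables (e : R) (u : nat -> R).
Hypothesis ne : n%:R * e = 1.
Hypothesis u0 : u 0%N = 1.
Hypothesis u_ge0 : forall j, (j <= k)%N -> 0 <= u j.

Let F t := \sum_(j < k.+1) u j * kern e k j t.

(** Level 0 has kernel 1 and weight 1, so it contributes the left side; the other levels contribute
    nonnegatively. *)
Lemma weights_psd_pairing B : psd_form B ->
  \sum_i \sum_i' B i i' <= \sum_i \sum_i' B i i' * F (card_cap i i').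
Proof.
move=> psdB.
have -> : \sum_i \sum_i' B i i' * F (card_cap i i') =
    \sum_(j < k.+1) u j * \sum_i \sum_i' B i i' * kern e k j (card_cap i i').
  under [RHS]eq_bigr do rewrite mulr_sumr.
  rewrite [RHS]exchange_big; apply: eq_bigr => i _ /=.
  under [RHS]eq_bigr do rewrite mulr_sumr.
  rewrite [RHS]exchange_big; apply: eq_bigr => i' _ /=.
  by rewrite mulr_sumr; apply: eq_bigr => j _; rewrite mulrCA.
rewrite big_ord_recl /= u0 mul1r.
have -> : \sum_i \sum_i' B i i' * kern e k 0 (card_cap i i') = \sum_i \sum_i' B i i'.
  apply: eq_bigr => i _; apply: eq_bigr => i' _.
  by rewrite /kern big_ord1 bin0 /kcoef bin0 expr0 !mulr1.
rewrite lerDl; apply: sumr_ge0 => j _; rewrite mulr_ge0 ?u_ge0 //.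
exact: kern_psd_pairing.
Qed.

(** Pairs [F] with the matrix whose only nonzero entry is a diagonal 1. *)
Lemma weights_value_ge1 : (k <= n)%N -> 1 <= F k.
Proof.
move=> kn.
have [A cA] : exists A : {set 'I_n}, #|A| == k.
  have := card_draws 'I_n k; rewrite card_ord => E.
  have : (0 < #|[set A : {set 'I_n} | #|A| == k]|)%N by rewrite E bin_gt0.
  by case/card_gt0P=> A; rewrite inE => cA; exists A.
pose a : ksub n k := exist _ A cA.
pose B (i j : ksub n k) : R := (i == a)%:R * (j == a)%:R.
have sum_a (f : ksub n k -> R) : \sum_i (i == a)%:R * f i = f a.
  rewrite (bigD1 a) //= eqxx mul1r big1 ?addr0 // => i /negPf ->.
  by rewrite mul0r.
have sumB (f : ksub n k -> ksub n k -> R) : \sum_i \sum_j B i j * f i j = f a a.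
  rewrite -(sum_a (fun i => f i a)); apply: eq_bigr => i _.
  by rewrite -(sum_a (f i)) mulr_sumr; apply: eq_bigr => j _; rewrite mulrA.
have psdB : psd_form B.
  move=> x; suff -> : \sum_i \sum_j x i * B i j * x j = x a * x a.
    by rewrite -expr2 sqr_ge0.
  rewrite -(sumB (fun i j => x i * x j)).
  by apply: eq_bigr => i _; apply: eq_bigr => j _; ring.
have := weights_psd_pairing B psdB.
rewrite (sumB (fun i j => F (card_cap i j))) capAA => h; apply: le_trans h.
have := sumB (fun _ _ => 1) => <-.
by apply: ler_sum => i _; apply: ler_sum => j _; rewrite mulr1.
Qed.

(** Off the diagonal either [B] vanishes (adjacent pair) or [F] does (intersection size in [L]), so
    the pairing of [B] with [F] is [F k] times the trace. *)
Lemma weights_upper (L : {set 'I_k}) B :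
  (forall l, l \in L -> F l = 0) ->
  theta_feasible (johnson_adj n L) B -> \sum_i \sum_j B i j <= F k.
Proof.
move=> FL [_ psdB trB adjB]; apply: le_trans (weights_psd_pairing _ psdB) _.
rewrite -[F k]mul1r -trB mulr_suml; apply: ler_sum => i _.
rewrite (bigD1 i) //= capAA big1 ?addr0 // => j; rewrite eq_sym => ij.
have [/existsP[l /andP[lL /eqP lE]]|nL] :=
    boolP [exists l in L, nat_of_ord l == card_cap i j].
  by rewrite -lE FL ?mulr0.
by rewrite adjB ?mul0r // /johnson_adj ij.
Qed.

(** The matrix is [F] itself scaled to trace 1: adjacent sets meet in a size outside [L], where [F]
    vanishes. *)
Lemma weights_lower (L : {set 'I_k}) : (k <= n)%N ->
  (forall l, l \notin L -> F l = 0) ->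
  exists B, theta_feasible (johnson_adj n L) B /\
    ('C(n, k))%:R / F k <= \sum_i \sum_j B i j.
Proof.
move=> kn FL; set N := 'C(n, k).
have cardV : #|{: ksub n k}| = N.
  rewrite card_sig /N -[in RHS](card_ord n) -card_draws.
  by apply: eq_card => A; rewrite !inE.
have N0 : 0 < N%:R :> R by rewrite ltr0n bin_gt0.
have Fk0 : 0 < F k by rewrite (lt_le_trans ltr01) // weights_value_ge1.
pose c := (N%:R * F k)^-1.
have c0 : 0 < c by rewrite invr_gt0 mulr_gt0.
exists (fun i j => c * F (card_cap i j)); split; first split.
- by move=> i j; rewrite cap_sym.
- move=> x.
  have -> : \sum_i \sum_j x i * (c * F (card_cap i j)) * x j =
      c * \sum_i \sum_j x i * x j * F (card_cap i j).
    rewrite mulr_sumr; apply: eq_bigr => i _; rewrite mulr_sumr.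
    by apply: eq_bigr => j _; ring.
  apply: mulr_ge0; first exact: ltW.
  have sqE (y : ksub n k -> R) : \sum_i \sum_j y i * y j = (\sum_i y i) ^+ 2.
    rewrite expr2 mulr_suml; apply: eq_bigr => i _.
    by rewrite mulr_sumr.
  (* Semidefiniteness of [F] comes from pairing it with the rank-one matrix of [x], whose entries
     sum to a square. *)
  apply: (le_trans _ (weights_psd_pairing (fun i j => x i * x j) _)).
    by rewrite sqE sqr_ge0.
  move=> y; have -> : \sum_i \sum_j y i * (x i * x j) * y j =
      \sum_i \sum_j (y i * x i) * (y j * x j).
    by apply: eq_bigr => i _; apply: eq_bigr => j _; ring.
  by rewrite (sqE (fun i => y i * x i)) sqr_ge0.
- under eq_bigr do rewrite capAA.
  rewrite sumr_const cardV -mulr_natl mulrA mulrAC /c; apply: divff.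
  by rewrite gt_eqF // mulr_gt0.
- move=> i j /andP[ij nL]; have lt := cap_lt _ _ ij.
  rewrite -[card_cap i j]/(nat_of_ord (Ordinal lt)) FL ?mulr0 //.
  apply: contra nL => lL; apply/existsP; exists (Ordinal lt).
  by rewrite lL eqxx.
have -> : \sum_i \sum_j c * F (card_cap i j) =
    c * \sum_i \sum_j 1 * F (card_cap i j).
  rewrite mulr_sumr; apply: eq_bigr => i _; rewrite mulr_sumr.
  by apply: eq_bigr => j _; rewrite mul1r.
have -> : N%:R / F k = c * N%:R ^+ 2 by rewrite /c; field; rewrite !gt_eqF.
rewrite ler_wpM2l ?(ltW c0) //.
(* Pairing with the all-ones matrix shows that the entries of [F] sum to at least [N ^ 2]. *)
apply: (le_trans _ (weights_psd_pairing (fun _ _ => 1) _)).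
  by rewrite sumr_const sumr_const cardV -mulrnA -natrX.
move=> y; have -> : \sum_i \sum_j y i * 1 * y j = (\sum_i y i) ^+ 2.
  rewrite expr2 mulr_suml; apply: eq_bigr => i _; rewrite mulr_sumr.
  by apply: eq_bigr => j _; rewrite mulr1.
exact: sqr_ge0.
Qed.

End Weights.
End Johnson.

(** * The constant *)

Section RunProducts.
Variables (P : pred nat) (k : nat).

(** The length of the run of [P] ending just below [t]. *)
Let d t := (t - gap_start (predC P) t)%N.

Lemma prod_run_from_down :
  (\prod_(t < k | P t) run_from P k t = \prod_(t < k | P t) (t.+1 - gap_start (predC P) t))%N.
Proof.
have dS t : P t -> d t.+1 = (d t).+1.
  by move=> Pt; rewrite /d /= Pt /= subSn ?gap_start_le.
have d0 t : ~~ P t -> d t.+1 = 0%N by move=> Pt; rewrite /d /= Pt subnn.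
have prodS (F : nat -> nat) x : (\prod_(t < x.+1 | P t) F t =
    (\prod_(t < x | P t) F t) * (if P x then F x else 1))%N.
  by rewrite big_mkcond big_ord_recr -big_mkcond.
(* On a run of length m both products are m!, taken downwards and upwards; the factorials correct
   for a run cut at [x], of full length [run_from P k x + d x]. *)
have main x : (x <= k)%N ->
  ((\prod_(t < x | P t) run_from P k t) * (run_from P k x)`! * (d x)`! =
   (\prod_(t < x | P t) (t.+1 - gap_start (predC P) t)) * (run_from P k x + d x)`!)%N.
  elim: x => [|x IH] xk; first by rewrite !big_ord0 /d /= addn0 muln1.
  have := IH (ltnW xk); rewrite prodS (prodS (fun t => t.+1 - gap_start (predC P) t)%N).
  rewrite (run_fromE P k x xk); case: (boolP (P x)) => Px E.
    rewrite dS // factS addnS addSn in E *.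
    rewrite subSn ?gap_start_le // -/(d x) (factS (d x)).
    rewrite [RHS]mulnAC -E; ring.
  rewrite d0 // !muln1 addn0; move: E; rewrite fact0 muln1 add0n => /eqP.
  by rewrite eqn_pmul2r ?fact_gt0 // => /eqP ->.
by have := main k (leqnn k); rewrite run_from_out // muln1 add0n => /eqP;
  rewrite eqn_pmul2r ?fact_gt0 // => /eqP.
Qed.

Lemma prod_run_from_starts :
  (\prod_(t < k | P t) run_from P k t =
   \prod_(t < k | P t) (if (t == 0 :> nat) || ~~ P t.-1 then (run_from P k t)`! else 1))%N.
Proof.
set G := fun t => if (t == 0)%N || ~~ P t.-1 then (run_from P k t)`! else 1%N.
(* The factorial outside the product is owed by a run cut at [x], whose first point lies below
   [x]. *)
have main i : forall x, (x + i = k)%N ->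
  (\prod_(x <= t < k | P t) run_from P k t =
   (if (x == 0) || ~~ P x.-1 then 1 else (run_from P k x)`!) * \prod_(x <= t < k | P t) G t)%N.
  elim: i => [|i IH] x xk.
    by rewrite !big_geq ?run_from_out ?if_same //; lia.
  have xk' : (x < k)%N by lia.
  have prodS (F : nat -> nat) : (\prod_(x <= t < k | P t) F t =
      (if P x then F x else 1) * \prod_(x.+1 <= t < k | P t) F t)%N.
    by rewrite big_mkcond big_ltn // -big_mkcond.
  rewrite !prodS (IH x.+1); last by lia.
  rewrite /G run_fromE //=; case: (P x) => /=; last by rewrite if_same !mul1n.
  by rewrite factS; case: ifP => _; rewrite ?mul1n ?mulnA.
by have := main k 0%N (add0n k); rewrite mul1n !big_mkord.
Qed.

End RunProducts.

Lemma eq_gap_start (P Q : pred nat) : P =1 Q -> gap_start P =1 gap_start Q.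
Proof. by move=> PQ; elim=> //= t ->; rewrite PQ. Qed.

(** At each point one growth is a run factor and the other a gap factor for the complement. Over all
    points these cancel by [prod_run_from_down], leaving k! over its square. *)
Lemma theta_coef_predC (R : realFieldType) (P : pred nat) (k : nat) :
  theta_coef R P k k * theta_coef R (predC P) k k = (k`!)%:R^-1.
Proof.
rewrite /theta_coef -big_split /=.
pose h (Q : pred nat) t : R :=
  if Q t then (run_from Q k t)%:R / (t.+1 - gap_start (predC Q) t)%:R else 1.
have hprod Q : \prod_(t < k) h Q t = 1.
  rewrite /h -big_mkcond prodf_div -!natr_prod prod_run_from_down divff //.
  rewrite pnatr_eq0 -lt0n prodn_cond_gt0 // => t _.
  by rewrite subn_gt0 ltnS gap_start_le.
transitivity (\prod_(t < k) (h P t * h (predC P) t * (t.+1%:R / (k - t)%:R ^+ 2))).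
  apply: eq_bigr => t _; rewrite /growth /h /=.
  have E : gap_start (predC (predC P)) t = gap_start P t.
    by apply: eq_gap_start => x /=; rewrite negbK.
  case: (P t) => /=; rewrite ?E; ring.
rewrite !big_split /= !hprod !mul1r prodfV prodrXl -!natr_prod.
have -> : (\prod_(i < k) (k - i) = k`!)%N by rewrite -ffact_prod ffactnn.
have -> : (\prod_(i < k) i.+1 = k`!)%N.
  by rewrite fact_prod big_add1 /= big_mkord.
by field; rewrite pnatr_eq0 -lt0n fact_gt0.
Qed.

Section Constant.
Variables (R : realType) (k : nat) (P : pred nat).
Let l := [seq t <- iota 0 k | P t].

Fixpoint bin_ratio (y : nat) (s : seq nat) : R :=
  if s is t :: s' then
    ('C(k - y, k - t))%:R / (t.+1 * (k - t))%:R * bin_ratio t.+1 s'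
  else 1.

Lemma bin_ratioE y s :
  bin_ratio y s =
  (\prod_(i < size s)
     'C(if i == 0 :> nat then k - y else k - nth 0 s i.-1 - 1, k - nth 0 s i))%:R /
  (\prod_(i < size s) ((nth 0 s i).+1 * (k - nth 0 s i)))%:R.
Proof.
elim: s y => [|t s IH] y; first by rewrite !big_ord0 divr1.
rewrite /= !big_ord_recl /= IH !natrM invfM mulrACA; congr (_ * _).
  congr (_ * _%:R); apply: eq_bigr => -[[|i] /= _] _; last by rewrite add0n.
  by rewrite -subnDA addn1.
by rewrite !invfM; under [in RHS]eq_bigr do rewrite add0n.
Qed.

(* Both sides are computed by running through [0, k-1] from the top, carrying
   the start of the current gap. *)
Lemma theta_coef_bin_ratio :
  theta_coef R P k k = (\prod_(t < k | P t) run_from P k t)%:R * bin_ratio 0 l.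
Proof.
pose g t : R := if P t then ((k - t)%:R ^+ 2)^-1
  else t.+1%:R / (t.+1 - gap_start P t)%:R.
have main i : forall x, (x + i = k)%N -> let y := gap_start P x in
    ('C(x, y))%:R * \prod_(x <= t < k) g t =
    ('C(k, y))%:R * bin_ratio y [seq t <- iota x i | P t].
  elim: i => [|i IH] x xk y; first by rewrite big_geq /= -xk ?addn0 ?leqnn.
  have xk' : (x < k)%N by lia.
  have yx : (y <= x)%N := gap_start_le P x.
  rewrite big_ltn // mulrA.
  have := IH x.+1; rewrite addSnnS xk => /(_ erefl) /=; rewrite /g.
  case: ifP => Px; rewrite ?Px.
    rewrite binn mul1r => -> /=; rewrite !mulrA; congr (_ * _).
    have kx : (k - x)%:R != 0 :> R by rewrite pnatr_eq0 subn_eq0 -ltnNge.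
    have sx : x.+1%:R != 0 :> R by rewrite pnatr_eq0.
    (* Both sides are k! / (y! (x - y)! (k - x - 1)!). *)
    have nat_id : ('C(x, y) * ('C(k, x.+1) * x.+1) =
                   'C(k, y) * 'C(k - y, k - x) * (k - x))%N.
      have -> : 'C(k - y, k - x) = 'C(k - y, x - y).
        by rewrite -(@bin_sub (k - y) (x - y)); [congr 'C(_, _)|]; lia.
      rewrite mulnC [('C(k, x.+1) * _)%N]mulnC mul_bin_left.
      have yk : (y <= k)%N by lia.
      have xk2 : (x <= k)%N := ltnW xk'.
      have xy : (x - y <= k - y)%N by lia.
      have := bin_fact yx; have := bin_fact yk; have := bin_fact xk2; have := bin_fact xy.
      have -> : (k - y - (x - y) = k - x)%N by lia.
      move=> e1 e2 e3 e4; rewrite mulnAC [RHS]mulnC -mulnA; congr (_ * _)%N.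
      have f0 : (0 < y`! * (x - y)`! * (k - x)`!)%N by rewrite !muln_gt0 !fact_gt0.
      apply/eqP; rewrite -(eqn_pmul2r f0); apply/eqP.
      transitivity k`!; first by rewrite -e2 -e4; ring.
      by rewrite -e3 -e1; ring.
    apply: (mulIf (expf_neq0 2 kx)); rewrite natrM.
    apply: (mulIf sx); have := congr1 (fun z => z%:R : R) nat_id.
    rewrite !natrM => E; transitivity ('C(x, y)%:R * ('C(k, x.+1)%:R * x.+1%:R) : R).
      by field.
    by rewrite E; field; rewrite kx nat1r sx.
  move=> <-; rewrite -/y; congr (_ * _).
  have n0 : (x.+1 - y)%:R != 0 :> R by rewrite pnatr_eq0; lia.
  apply: (mulIf n0); rewrite -!mulrA mulVf // mulr1.
  by rewrite -!natrM; congr (_%:R); have := mul_bin_down x.+1 y; rewrite /=; lia.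
have := main k 0%N (add0n k); rewrite /= !bin0 !mul1r big_mkord => <-.
rewrite big_mkcond natr_prod -big_split /=; apply: eq_bigr => t _.
by rewrite /growth /g; case: (P t); rewrite ?mul1r.
Qed.

Let size_l : size l = rank P k.
Proof. by rewrite size_filter. Qed.

Let nth_rank t : (t < k)%N -> P t -> nth 0%N l (rank P t) = t.
Proof.
move=> tk Pt; rewrite /l -(subnKC (ltnW tk)) iotaD filter_cat add0n.
rewrite nth_cat size_filter ltnn subnn.
by have -> : (k - t = (k - t.+1).+1)%N by [lia]; rewrite /= Pt.
Qed.

Let rank_lt t : (t < k)%N -> P t -> (rank P t < size l)%N.
Proof.
move=> tk Pt; rewrite size_l; apply: leq_trans (rank_le P _ _ tk).
by rewrite rankS Pt addn1.
Qed.

Let nthP j : (j < size l)%N -> let t := nth 0%N l j in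
  [/\ (t < k)%N, P t & rank P t = j].
Proof.
move=> js t; have : t \in l by rewrite mem_nth.
rewrite mem_filter mem_iota add0n => /and3P[Pt _ tk]; split=> //.
apply/eqP; rewrite -(nth_uniq 0%N (rank_lt _ tk Pt) js) ?filter_uniq ?iota_uniq //.
by rewrite nth_rank.
Qed.

Let nth_lt i j : (i < j)%N -> (j < size l)%N -> (nth 0%N l i < nth 0%N l j)%N.
Proof.
move=> ij js; have sl : sorted ltn l.
  exact: (sorted_filter ltn_trans _ (iota_ltn_sorted 0 k)).
by apply: (sorted_ltn_nth ltn_trans 0%N sl) => //; rewrite inE //; apply: ltn_trans js.
Qed.

(** Passes from list positions to points through [rank], the inverse of [nth]; [p] is the last
    offset of the run, so its length is [p.+1]. *)
Lemma full_runE j p : (j < size l)%N -> let a := nth 0%N l j in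
  full_run l j p = ((a == 0%N) || ~~ P a.-1) && (p.+1 == run_from P k a).
Proof.
move=> js a; have [ak Pa ja] := nthP _ js; rewrite -/a in ak Pa ja.
have m_k := run_from_le P k a.
have runP i : (i < run_from P k a)%N -> P (a + i)%N /\ rank P (a + i) = (j + i)%N.
  move=> im; have aik : (a + i.+1 <= k)%N by lia.
  have := leq_run_from P _ _ _ aik; rewrite im -addn1 iotaD count_cat /= addn0.
  have := count_size P (iota a i); rewrite size_iota rankD ja => h /esym/eqP.
  by case: (P _) => /=; lia.
apply/and4P/andP => [[jps /forallP run st en]|[st /eqP pE]].
  have runA i : (i <= p)%N -> nth 0%N l (j + i) = (a + i)%N.
    by move=> ip; have /eqP := run (Ordinal (ip : (i < p.+1)%N)).
  have p_up : (p < run_from P k a)%N.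
    have [bk Pb rb] := nthP _ jps; rewrite runA // in bk Pb rb.
    rewrite leq_run_from; last by lia.
    have := rankD P a p; rewrite rb ja => /addnI cp.
    by rewrite -addn1 iotaD count_cat /= -cp Pb addn0.
  split.
    case: (posnP a) => //= a0; apply/negP => Pa1.
    have a1k : (a.-1 < k)%N by lia.
    have := rankS P a.-1; rewrite prednK // ja Pa1 addn1 => jE.
    by move: st; rewrite jE /= nth_rank // -/a -jE -/a; lia.
  (* If the run went on, [a + p.+1] would be the next entry of [l], against [en]. *)
  rewrite eqn_leq p_up leqNgt; apply/negP => pm.
  have [Pb rb] := runP _ pm; have bk : (a + p.+1 < k)%N by lia.
  have := rank_lt _ bk Pb; rewrite rb => js'.
  move: en; rewrite -(addnS j p) -rb nth_rank // runA //; lia.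
have jb i : (i <= p)%N -> nth 0%N l (j + i) = (a + i)%N.
  move=> ip; have [|Pi ri] := runP i; first by lia.
  by rewrite -ri nth_rank //; lia.
have [|Pp rp] := runP p; first by lia.
have jps : (j + p < size l)%N by rewrite -rp rank_lt //; lia.
split=> //.
- by apply/forallP => -[i /= ip]; rewrite jb.
- case: (posnP j) => //= j0.
  have j1 : (j.-1 < j)%N by rewrite prednK.
  have [ck Pc rc] := nthP _ (ltn_trans j1 js).
  have := nth_lt _ _ j1 js; rewrite -/a addn1 => ca.
  rewrite ltn_neqAle ca andbT; apply/eqP => cE.
  by move: st; rewrite -cE /= Pc.
case: (ltnP (j + p).+1 (size l)) => [jp1|]; last by move=> h; apply/orP; left; lia.
have [ck Pc rc] := nthP _ jp1; set c := nth 0%N l (j + p).+1 in ck Pc rc *.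
have := nth_lt _ _ (ltnSn (j + p)) jp1; rewrite jb // -/c => bc.
apply/orP; right; rewrite addn1 ltn_neqAle bc andbT; apply/eqP => cE.
have ack : (a + p.+2 <= k)%N by rewrite !addnS cE.
have : (p.+2 <= run_from P k a)%N.
  rewrite leq_run_from //.
  rewrite -addn1 iotaD count_cat -addn1 iotaD count_cat /= !addn0 addn1.
  have := rankD P a p; rewrite rp ja => /addnI <-.
  by rewrite (addnS a p) cE Pc Pp !addn1.
by lia.
Qed.

Lemma prod_full_run :
  (\prod_(j < size l) \prod_(p < size l | full_run l j p) (p.+1)`! =
   \prod_(t < k | P t) run_from P k t)%N.
Proof.
rewrite prod_run_from_starts.
pose G t := if (t == 0)%N || ~~ P t.-1 then (run_from P k t)`! else 1%N.
transitivity (\prod_(j < size l) G (nth 0 l j))%N.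
  apply: eq_bigr => -[j /= js] _; have [ak Pa ja] := nthP _ js.
  rewrite /G; under eq_bigl => p do rewrite (full_runE _ _ js).
  case: ifP => _ /=; last by rewrite big_pred0.
  set a := nth 0%N l j in ak Pa ja *.
  have up0 : (0 < run_from P k a)%N by rewrite run_fromE // Pa.
  have ps : ((run_from P k a).-1 < size l)%N.
    have h : (run_from P k a <= rank P (a + run_from P k a))%N.
      rewrite rankD; have := leqnn (run_from P k a); rewrite leq_run_from => [/eqP ->|].
        by rewrite leq_addl.
      by have := run_from_le P k a; lia.
    have := rank_le P (a + run_from P k a) k; rewrite -size_l.
    by have := run_from_le P k a; lia.
  rewrite (big_pred1 (Ordinal ps)) /= ?prednK // => p /=.
  by rewrite -val_eqE /=; lia.
rewrite -(big_mkord xpredT (fun j => G (nth 0 l j)))%N -(big_nth 0%N xpredT G) big_filter.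
by rewrite -[in RHS](big_mkord P G) /index_iota subn0.
Qed.

End Constant.

Section Mask.
Variables (k : nat) (L : {set 'I_k}).

Definition mask_of (t : nat) : bool := [exists x in L, nat_of_ord x == t].

Lemma mask_ofE (x : 'I_k) : mask_of x = (x \in L).
Proof.
apply/existsP/idP => [[y /andP[yL /eqP/val_inj <-]] //|xL].
by exists x; rewrite xL eqxx.
Qed.

Lemma LseqE : Lseq L = [seq t <- iota 0 k | mask_of t].
Proof.
apply: (sorted_eq leq_trans anti_leq).
- exact: sort_sorted leq_total _.
- by rewrite sorted_filter ?iota_sorted //; apply: leq_trans.
rewrite /Lseq perm_sort; apply: uniq_perm.
- by rewrite map_inj_uniq ?enum_uniq //; apply: val_inj.
- by rewrite filter_uniq ?iota_uniq.
move=> t; rewrite mem_filter mem_iota add0n /=; apply/mapP/andP.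
  by move=> [x]; rewrite mem_enum => xL ->; rewrite mask_ofE.
move=> [mt tk]; exists (Ordinal tk) => //.
by rewrite mem_enum -mask_ofE.
Qed.

Lemma Kconst_theta_coef (R : realType) : Kconst R L = theta_coef R mask_of k k.
Proof.
rewrite theta_coef_bin_ratio bin_ratioE mulrA -natrM -prod_full_run.
by rewrite /Kconst LseqE subn0.
Qed.

End Mask.

(** * Asymptotics *)

(** Each factor of the falling factorial is at least [n * (1 - x)]; then Bernoulli's inequality. *)
Lemma bin_ge_pow (R : realFieldType) (n k : nat) : (0 < n)%N -> (k <= n)%N ->
  n%:R ^+ k * (1 - k%:R ^+ 2 / n%:R) <= ('C(n, k))%:R * k`!%:R :> R.
Proof.
move=> n0 kn; have n0' : 0 < n%:R :> R by rewrite ltr0n.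
set x : R := k%:R / n%:R.
have x0 : 0 <= x by rewrite divr_ge0.
have nx : n%:R * x = k%:R by rewrite mulrC divfK // gt_eqF.
rewrite -natrM bin_ffact (_ : _ ^+ 2 / _ = k%:R * x); last by rewrite /x; ring.
have x1 : x <= 1 by rewrite ler_pdivrMr // mul1r ler_nat.
suff main m : (m <= k)%N -> n%:R ^+ m * (1 - m%:R * x) <= (n ^_ m)%:R.
  exact: main.
elim: m => [|m IH] mk; first by rewrite ffactn0 expr0 mul0r subr0 mulr1.
rewrite ffactnSr natrM natrB; last by lia.
apply: (@le_trans _ _ ((n ^_ m)%:R * (n%:R * (1 - x)))); last first.
  by rewrite ler_wpM2l // mulrBr mulr1 nx lerD2l lerN2 ler_nat ltnW.
apply: (@le_trans _ _ (n%:R ^+ m * (1 - m%:R * x) * (n%:R * (1 - x)))); last first.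
  by rewrite ler_wpM2r ?IH ?(ltnW mk) // mulr_ge0 ?(ltW n0') // subr_ge0.
rewrite mulrACA -exprSr ler_wpM2l ?exprn_ge0 ?(ltW n0') //.
have mx : 0 <= m%:R * x * x by do 2?[apply: mulr_ge0 => //].
by rewrite -natr1; nra.
Qed.

(** The finitely many [n < N] are absorbed by adding their ratios to the constant. *)
Lemma eventually_le_all (R : realFieldType) (k : nat) (f h : nat -> R) :
  (forall n, (k < n)%N -> 0 < h n) ->
  (exists (C : R) (N : nat), forall n, (N <= n)%N -> f n <= C * h n) ->
  exists C : R, forall n, (k < n)%N -> f n <= C * h n.
Proof.
move=> h0 [C [N fC]]; pose S := \sum_(m < N) `|f m| / `|h m|.
have term0 m : 0 <= `|f m| / `|h m| by rewrite divr_ge0.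
exists (`|C| + S) => n kn; have hn := h0 n kn.
have S0 : 0 <= S by apply: sumr_ge0.
case: (leqP N n) => [/fC fn|nN].
  apply: le_trans fn _; rewrite ler_wpM2r ?(ltW hn) //.
  by rewrite (le_trans (ler_norm C)) // lerDl.
apply: (@le_trans _ _ (`|f n| / `|h n| * h n)).
  by rewrite (gtr0_norm hn) divfK ?gt_eqF // ler_norm.
rewrite ler_wpM2r ?(ltW hn) // /S (bigD1 (Ordinal nN)) //= addrCA lerDl.
by rewrite addr_ge0 // sumr_ge0.
Qed.

Section Asymptotics.
Context {R : realType} (k : nat) (L : {set 'I_k}).
Let P := mask_of k L.
Let s := rank P k.
Let theta n : R := lovasz_theta (johnson_adj n L).

(** Stated for every feasible matrix because the lower bound on theta also needs the set of values
    to be bounded. *)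
Let upper_weights : exists (C : R) (N : nat), forall n, (N <= n)%N -> (0 < n)%N ->
  exists x : R, [/\ 0 <= x,
    forall B : ksub n k -> ksub n k -> R,
      theta_feasible (johnson_adj n L) B -> \sum_i \sum_j B i j <= x &
    x <= theta_coef R P k k * n%:R ^+ s + C * (n%:R ^+ s / n%:R)].
Proof.
have [C [N H]] := @dual_weights R P k.
exists C, (maxn N k) => n; rewrite geq_max => /andP[Nn kn] n0.
have [u [u0 u_ge0 rows val]] := H n Nn.
have ne : n%:R * n%:R^-1 = 1 :> R by rewrite divff // pnatr_eq0 -lt0n.
exists (\sum_(j < k.+1) u j * kern n%:R^-1 k j k); split.
- exact: le_trans ler01 (weights_value_ge1 _ _ _ _ ne u0 u_ge0 kn).
- move=> B; apply: (weights_upper _ _ _ _ ne u0 u_ge0) => l lL.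
  by rewrite rows // /P mask_ofE.
by move: val; rewrite ler_distl => /andP[].
Qed.

Lemma lovasz_theta_upper : exists (C : R) (N : nat), forall n, (N <= n)%N ->
  theta n - theta_coef R P k k * n%:R ^+ s <= C * (n%:R ^+ s / n%:R).
Proof.
have [C [N H]] := upper_weights; exists C, N.+1 => n Nn.
have [|x [x0 xB xC]] := H n (ltnW Nn); first by lia.
by rewrite lerBlDl; apply: le_trans xC; apply: lovasz_theta_le.
Qed.

Lemma lovasz_theta_lower : exists (C : R) (N : nat), forall n, (N <= n)%N ->
  theta_coef R P k k * n%:R ^+ s - theta n <= C * (n%:R ^+ s / n%:R).
Proof.
have [C1 [N1 H1]] := upper_weights.
have [C [N H]] := @dual_weights R (predC P) k.
set K := theta_coef R P k k; set K' := theta_coef R (predC P) k k in H *.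
have KK' : K * K' = (k`!)%:R^-1 by apply: theta_coef_predC.
have K0 : 0 < K by apply: theta_coef_gt0.
have K'0 : 0 < K' by apply: theta_coef_gt0.
set b := `|C| / K'.
have b0 : 0 <= b by rewrite divr_ge0 // ltW.
(* [k ^ 2] is the loss in ['C(n, k)] and [b] the relative error of [F]; the threshold ensures
   [k <= n] and [k ^ 2 <= n]. *)
exists (K * (k%:R ^+ 2 + b)), (maxn (maxn N1 N) (k ^ 2 + k.+1)) => n.
rewrite !geq_max => /andP[/andP[N1n Nn] kn].
have n0 : (0 < n)%N by lia.
have kn' : (k <= n)%N by lia.
have nR : 0 < n%:R :> R by rewrite ltr0n.
have ne : n%:R * n%:R^-1 = 1 :> R by rewrite divff // gt_eqF.
have [u [u0 u_ge0 rows val]] := H n Nn.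
have [x [_ xB _]] := H1 n N1n n0.
set F := \sum_(j < k.+1) _ in val.
have F1 : 1 <= F := weights_value_ge1 _ _ _ _ ne u0 u_ge0 kn'.
have [|B [FB BF]] := weights_lower _ _ _ _ ne u0 u_ge0 L kn'.
  by move=> l lL; rewrite rows //= /P mask_ofE.
rewrite -/F in BF.
have thetaF : ('C(n, k))%:R / F <= theta n.
  by apply: le_trans BF _; apply: le_lovasz_theta xB FB.
have sk : (s + rank (predC P) k = k)%N by rewrite /s /rank count_predC size_iota.
set r := rank (predC P) k in val sk.
set e : R := n%:R^-1 in ne val *.
have e0 : 0 < e by rewrite invr_gt0.
have Fle : F <= K' * n%:R ^+ r * (1 + b * e).
  move: val; rewrite ler_distl => /andP[_ h]; apply: le_trans h _.
  rewrite [leRHS]mulrDr mulr1 lerD2l.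
  have -> : K' * n%:R ^+ r * (b * e) = `|C| * (n%:R ^+ r * e).
    by rewrite /b; field; rewrite gt_eqF.
  by rewrite ler_wpM2r ?ler_norm // mulr_ge0 ?exprn_ge0 ?(ltW e0) ?(ltW nR).
set a : R := k%:R ^+ 2 * e.
have a1 : a <= 1.
  by rewrite /a ler_pdivrMr // mul1r -natrX ler_nat; lia.
have be0 : 0 <= b * e by rewrite mulr_ge0 // ltW.
have nr0 : 0 < n%:R ^+ r :> R by rewrite exprn_gt0.
have ns0 : 0 < n%:R ^+ s :> R by rewrite exprn_gt0.
(* [thetaF] yields [K * n ^ s * (1 - a) / (1 + b * e)] as a lower bound, and
   [(1 - a - b * e) * (1 + b * e) <= 1 - a]. *)
suff main : K * n%:R ^+ s * (1 - a - b * e) <= theta n.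
  have -> : K * (k%:R ^+ 2 + b) * (n%:R ^+ s * e) =
     K * n%:R ^+ s - K * n%:R ^+ s * (1 - a - b * e) by rewrite /a; ring.
  by rewrite lerD2l lerN2.
apply: le_trans thetaF; rewrite ler_pdivlMr; last by rewrite (lt_le_trans ltr01).
have kf : 0 < k`!%:R :> R by rewrite ltr0n fact_gt0.
have [neg|pos] := ltP (1 - a - b * e) 0.
  apply: (@le_trans _ _ 0); last by [].
  by rewrite mulr_le0_ge0 ?(le_trans ler01) //
    mulr_ge0_le0 ?mulr_ge0 ?(ltW K0) ?(ltW ns0) ?(ltW neg).
apply: (@le_trans _ _ (K * n%:R ^+ s * (1 - a - b * e) * (K' * n%:R ^+ r * (1 + b * e)))).
  by rewrite ler_wpM2l // !mulr_ge0 // ltW.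
have bin := bin_ge_pow R n k n0 kn'; rewrite -/e -/a in bin.
rewrite -(ler_pM2r kf); apply: le_trans bin.
have -> : K * n%:R ^+ s * (1 - a - b * e) * (K' * n%:R ^+ r * (1 + b * e)) * k`!%:R
   = (K * K' * k`!%:R) * (n%:R ^+ s * n%:R ^+ r) * ((1 - a - b * e) * (1 + b * e)).
  by move: (n%:R ^+ s) (n%:R ^+ r) => *; ring.
rewrite KK' mulVf ?gt_eqF // mul1r -exprD sk ler_wpM2l ?exprn_ge0 ?(ltW nR) //.
have a0 : 0 <= a by rewrite mulr_ge0 ?exprn_ge0 // ltW.
nra.
Qed.

End Asymptotics.

Theorem theorem1 (R : realType) (k : nat) (L : {set 'I_k}) :
  (0 < k)%N ->
  let s := size (Lseq L) in
  (exists c : R, forall n : nat, (k < n)%N ->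
     Kconst R L * n%:R ^+ s - c * n%:R ^ (s%:Z - 1)
       <= lovasz_theta (R:=R) (johnson_adj n L)) /\
  (exists C : R, forall n : nat, (k < n)%N ->
     lovasz_theta (R:=R) (johnson_adj n L)
       <= Kconst R L * n%:R ^+ s + C * n%:R ^ (s%:Z - 1)).
Proof.
move=> _ s; rewrite Kconst_theta_coef.
have sE : s = rank (mask_of k L) k by rewrite /s LseqE size_filter.
(* The exponent is an integer, equal to -1 when [L] is empty; the quotient form covers this case. *)
have powE n : (k < n)%N -> n%:R ^ (s%:Z - 1) = n%:R ^+ s / n%:R :> R.
  by move=> kn; rewrite expfzDr ?exprN1 // pnatr_eq0; lia.
have h0 n : (k < n)%N -> 0 < n%:R ^+ s / n%:R :> R.
  by move=> kn; rewrite divr_gt0 ?exprn_gt0 // ltr0n; lia.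
split.
  have := @lovasz_theta_lower R k L; rewrite -sE.
  case/(eventually_le_all _ k _ _ h0) => c H; exists c => n kn.
  by rewrite powE // lerBlDr -lerBlDl H.
have := @lovasz_theta_upper R k L; rewrite -sE.
case/(eventually_le_all _ k _ _ h0) => C H; exists C => n kn.
by rewrite powE // -lerBlDl H.
Qed.
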